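(* Let $\mathcal{N}=\{1,\dots,N\}$ be a set of $N$ files with popularity distribution $p_1,\dots,p_N$, let there be $K$ users each with normalized cache size $M\ge 0$, and let $\mathcal{N}_1,\dots,\mathcal{N}_L$ be any partition of $\mathcal{N}$, with $N_\ell=|\mathcal{N}_\ell|$. For each $\ell$, let $\mathsf{K}_\ell$ be the (random) number of users whose demand lies in $\mathcal{N}_\ell$. Then \[ R^\star(M,\mathcal{N},K)\;\le\;\min_{\{M_\ell\}:\,M_\ell\ge 0,\ \sum_{\ell} M_\ell=M}\ \sum_{\ell=1}^L \mathbb{E}\bigl(R(M_\ell,N_\ell,\mathsf{K}_\ell)\bigr)\;\le\;\sum_{\ell=1}^L \mathbb{E}\bigl(R(M/L,N_\ell,\mathsf{K}_\ell)\bigr), \] where the expectations are over the random demands.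
   Context: Caching problem: a server holds $N$ files, each of $F$ bits, and is connected through a shared error-free link to $K$ users, each with a cache of $MF$ bits. In the placement phase (before demands are known), each user stores an arbitrary function of the $N$ files of at most $MF$ bits. In the delivery phase, each user $k$ independently requests a file $\mathsf{d}_k$, where $\Pr(\mathsf{d}_k=n)=p_n$; the server, knowing the demands, sends a message over the shared link, and each user must reconstruct its requested file from this message and its cache. The rate of a scheme for a demand vector is the message length divided by $F$; the expected rate is its expectation over the demands. The optimal expected rate $R^\star(M,\mathcal{N},K)$ is the infimum of expected rates achievable (with vanishing error probability, for all sufficiently large $F$) over all placement and delivery schemes. Thus $\mathsf{K}_\ell$ is Binomial$(K,\sum_{n\in\mathcal{N}_\ell}p_n)$. The function $R$ is defined for real $M\ge 0$ and integers $N\ge1$, $K\ge 0$ by $R(M,N,K)=(1-M/N)\min\{\tfrac{N}{M}(1-(1-M/N)^K),\,N\}$ for $M\in(0,N]$ (equivalently $K(1-M/N)\min\{\frac{N}{KM}(1-(1-M/N)^K),\frac{N}{K}\}$ when $K\ge1$), $R(0,N,K)=\min\{N,K\}$, and $R(M,N,K)=0$ for $M>N$. *)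

(* Defs.v *)
From HB Require Import structures.
From mathcomp Require Import all_boot all_order all_algebra.
From mathcomp Require Import classical_sets reals.

Set Implicit Arguments.
Unset Strict Implicit.
Unset Printing Implicit Defensive.

Import Order.TTheory GRing.Theory Num.Theory.
Local Open Scope ring_scope.

Definition files (N F : nat) := {ffun 'I_N -> F.-tuple bool}.
Definition demand (N K : nat) := {ffun 'I_K -> 'I_N}.

(* A placement + delivery scheme for file size F bits.
   Placement: user k stores a function of the files of cache_len k bits.
   Delivery: for demand d the server sends msg_len d bits computed from the
   files (knowing d); user k decodes from the message and its cache. *)
Record scheme (N K F : nat) := Scheme {
  cache_len : 'I_K -> nat;
  cache : forall k : 'I_K, files N F -> (cache_len k).-tuple bool;
  msg_len : demand N K -> nat;
  encode : forall d : demand N K, files N F -> (msg_len d).-tuple bool;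
  decode : forall (d : demand N K) (k : 'I_K),
      (msg_len d).-tuple bool -> (cache_len k).-tuple bool -> F.-tuple bool
}.

Arguments cache_len {N K F} _ _.
Arguments cache {N K F} _ _ _.
Arguments msg_len {N K F} _ _.
Arguments encode {N K F} _ _ _.
Arguments decode {N K F} _ _ _ _ _.

Section Caching.
Variable R : realType.

Definition cache_ok (N K F : nat) (M : R) (S : scheme N K F) : Prop :=
  forall k, (cache_len S k)%:R <= M * F%:R.

(* Probability (files uniform and independent) that some user decodes its
   requested file wrongly, for demand d. *)
Definition err_prob (N K F : nat) (S : scheme N K F) (d : demand N K) : R :=
  (#|[set W : files N F |
       [exists k : 'I_K, decode S d k (encode S d W) (cache S k W) != W (d k)]]|)%:R
  / (#|{: files N F}|)%:R.

(* Probability of a demand vector: users request independently with law p. *)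
Definition dprob (N K : nat) (p : 'I_N -> R) (d : demand N K) : R :=
  \prod_(k < K) p (d k).

Definition exp_rate (N K F : nat) (p : 'I_N -> R) (S : scheme N K F) : R :=
  \sum_(d : demand N K) dprob p d * ((msg_len S d)%:R / F%:R).

Definition achievable (N K : nat) (M : R) (p : 'I_N -> R) (r : R) : Prop :=
  forall eps : R, 0 < eps -> exists F0 : nat, forall F : nat, (F0 <= F)%N ->
    exists S : scheme N K F,
      [/\ cache_ok M S, (forall d, err_prob S d <= eps) & exp_rate p S <= r].

Definition Rstar (N K : nat) (M : R) (p : 'I_N -> R) : R :=
  inf [set r : R | achievable K M p r].

Definition Rfun (M : R) (N K : nat) : R :=
  if M == 0 then (minn N K)%:R
  else if M <= N%:R then
    (1 - M / N%:R) * Num.min ((N%:R / M) * (1 - (1 - M / N%:R) ^+ K)) N%:R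
  else 0.

(* Partition of the files given by blk : 'I_N -> 'I_L (block of each file). *)
Definition block_size (N L : nat) (blk : 'I_N -> 'I_L) (l : 'I_L) : nat :=
  #|[set n | blk n == l]|.

Definition block_users (N K L : nat) (blk : 'I_N -> 'I_L) (l : 'I_L)
    (d : demand N K) : nat :=
  #|[set k | blk (d k) == l]|.

Definition split_rate (N K L : nat) (p : 'I_N -> R) (blk : 'I_N -> 'I_L)
    (Ms : 'I_L -> R) : R :=
  \sum_(l < L) \sum_(d : demand N K)
     dprob p d * Rfun (Ms l) (block_size blk l) (block_users blk l d).

Definition feasible_split (L : nat) (M : R) (Ms : 'I_L -> R) : Prop :=
  (forall l, 0 <= Ms l) /\ \sum_(l < L) Ms l = M.

End Caching.

(* Main.v *)
(* Put q := max(0, 1 - M_l/N_l), the fraction of a file of block l that a user does not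
   cache.  Then R(M_l, N_l, K) = min(q + q^2 + ... + q^K, q N_l), which is continuous in
   M_l, so the minimum over the compact simplex of memory splits is attained.

   Achievability needs no randomness.  Up to rounding, cut each file of block l into
   fragments indexed by the sets S of users, of size q^(K-|S|) (1-q)^|S| F, and let user k
   store the fragments with k in S.  For a group U of users and a set T meeting U, the XOR
   over k in T and U of the fragment T \ {k} of the file requested by k gives each such k
   its missing fragment.  Sending these XORs for all T costs q + ... + q^|U|.  When all of
   U wants the same file, the sets T through one fixed user suffice, which costs q per
   requested file.  The cheaper option in each block gives R(M_l, N_l, K_l). *)
Require Import Defs.
From HB Require Import structures.
From mathcomp Require Import all_boot all_order all_algebra.
From mathcomp Require Import classical_sets reals topology normedtype derive realfun.
From mathcomp Require Import finset ring lra.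
Import Order.TTheory GRing.Theory Num.Theory numFieldNormedType.Exports.
Local Open Scope ring_scope.
Set Implicit Arguments.
Unset Strict Implicit.
Unset Printing Implicit Defensive.

(** * Schemes from determined decoding *)

(** No decoder has to be built: it searches for any files consistent with the message and the cache,
    and determinacy makes its answer right. Arbitrary finite index types avoid numbering the bits by
    hand. *)
Lemma zero_error_scheme (N K F : nat) (C : 'I_K -> finType)
    (cf : forall k, files N F -> C k -> bool) (I : demand N K -> finType)
    (mf : forall d, files N F -> I d -> bool) :
  (forall d k W W', cf k W =1 cf k W' -> mf d W =1 mf d W' ->
     W (d k) = W' (d k)) ->
  exists S : scheme N K F,
    [/\ forall k, cache_len S k = #|C k|, forall d, msg_len S d = #|I d|
      & forall d k W, decode S d k (encode S d W) (cache S k W) = W (d k)].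
Proof.
move=> determined.
pose ca k W := [tuple cf k W (enum_val i) | i < #|C k|].
pose en d W := [tuple mf d W (enum_val i) | i < #|I d|].
pose de d k (m : #|I d|.-tuple bool) (s : #|C k|.-tuple bool) :=
  if [pick W | (en d W == m) && (ca k W == s)] is Some W then W (d k)
  else [tuple of nseq F false].
exists (Scheme ca en de); split=> // d k W /=.
(* The search cannot fail, since [W] itself matches; the all-false default is never returned
   here. *)
rewrite /de; case: pickP => [W' /andP[/eqP enW /eqP caW]|/(_ W)]; last first.
  by rewrite !eqxx.
apply: determined => x; rewrite -(enum_rankK x).
  by have /(congr1 (fun t => tnth t (enum_rank x))) := caW; rewrite !tnth_mktuple.
by have /(congr1 (fun t => tnth t (enum_rank x))) := enW; rewrite !tnth_mktuple.
Qed.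

(** * Fragment sizes *)

Section FragmentCounting.
Local Open Scope nat_scope.
Variables (K a b : nat).

(** [(a + b) ^ K] times the probability of a given set of [s] users when each user joins
    independently with probability [a / (a + b)]. *)
Definition fragment_weight (s : nat) := a ^ s * b ^ (K - s).

Lemma fragment_weightE (S : {set 'I_K}) :
  fragment_weight #|S| = \prod_(i < K) (if i \in S then a else b).
Proof.
rewrite (bigID (mem S)) /= (eq_bigr (fun=> a)); last by move=> i ->.
rewrite [X in _ * X](eq_bigr (fun=> b)); last by move=> i /negbTE ->.
rewrite !prod_nat_const /fragment_weight; congr (_ * b ^ _).
have := cardsCs S; rewrite card_ord => ->.
rewrite subKn; last by rewrite -[leqRHS]card_ord max_card.
by apply: eq_card => i; rewrite inE.
Qed.

(** Expand a product of binomials whose first entry is 0 on [U] and [a] elsewhere: only the sets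
    avoiding [U] survive. *)
Lemma sum_fragment_weight_avoid (U : {set 'I_K}) :
  \sum_(S : {set 'I_K} | S :&: U == set0) fragment_weight #|S| =
  b ^ #|U| * (a + b) ^ (K - #|U|).
Proof.
transitivity (\prod_(i < K) ((if i \in U then 0 else a) + b)).
  rewrite bigA_distr big_mkcond /=; apply: eq_bigr => S _.
  case: ifPn => [/eqP SU0|/set0Pn[k]].
    rewrite fragment_weightE; apply: eq_bigr => i _; case: ifPn => // iS.
    by case: ifPn => // iU; have := in_set0 i; rewrite -SU0 inE iS iU.
  by rewrite inE => /andP[kS kU]; rewrite (bigD1 k) //= kS kU mul0n.
rewrite (bigID (mem U)) /= (eq_bigr (fun=> b)); last by move=> i ->.
rewrite [X in _ * X](eq_bigr (fun=> a + b)); last by move=> i /negbTE ->.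
rewrite !prod_nat_const; congr (_ * _ ^ _).
have := cardsCs U; rewrite card_ord => ->.
rewrite subKn; last by rewrite -[leqRHS]card_ord max_card.
by apply: eq_card => i; rewrite inE.
Qed.

Lemma sum_fragment_weight :
  \sum_(S : {set 'I_K}) fragment_weight #|S| = (a + b) ^ K.
Proof.
have := sum_fragment_weight_avoid set0; rewrite cards0 expn0 mul1n subn0 => <-.
apply: eq_bigl => S.
by rewrite setI0 eqxx.
Qed.

(** Remove the sets avoiding [k] from the total; the result measures what one user caches. *)
Lemma sum_fragment_weight_mem (k : 'I_K) :
  \sum_(S : {set 'I_K} | k \in S) fragment_weight #|S| = a * (a + b) ^ K.-1.
Proof.
have K0 : 0 < K by case: k => k; case: (K).
apply/eqP; rewrite -(eqn_add2r (b * (a + b) ^ K.-1)) -mulnDl -expnS prednK //.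
rewrite -sum_fragment_weight [X in _ == X](bigID (fun S : {set 'I_K} => k \in S)) /=.
have := sum_fragment_weight_avoid [set k].
rewrite cards1 expn1 subn1 => <-; rewrite eqn_add2l; apply/eqP/eq_bigl => S.
by rewrite setI_eq0 disjoint_sym disjoints1.
Qed.

(* Adding a user [k] to [U] adds the sets [T] with [k \in T] that avoid the old [U];
   dropping [k] from them turns the sum into one over the sets avoiding [k |: U]. *)
Lemma sum_fragment_weight_meet (U : {set 'I_K}) :
  \sum_(T : {set 'I_K} | T :&: U != set0) fragment_weight #|T|.-1 =
  \sum_(i < #|U|) b ^ i.+1 * (a + b) ^ (K - i.+1).
Proof.
move En : #|U| => n; elim: n U En => [|n IHn] U cardU.
  rewrite big_ord0; apply: big_pred0 => T.
  by move/eqP: cardU; rewrite cards_eq0 => /eqP ->; rewrite setI0 eqxx.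
have [k kU] : exists k, k \in U by apply/set0Pn; rewrite -cards_eq0 cardU.
have cardU' : #|U :\ k| = n by move: cardU; rewrite (cardsD1 k) kU => -[].
rewrite big_ord_recr /= -(IHn _ cardU') -cardU -sum_fragment_weight_avoid.
rewrite (bigID (fun T : {set 'I_K} => T :&: (U :\ k) != set0)) /=; congr (_ + _).
  apply: eq_bigl => T; rewrite andb_idl // => /set0Pn[j].
  by rewrite !inE => /and3P[jT _ jU]; apply/set0Pn; exists j; rewrite inE jT.
rewrite (reindex_onto (fun S => k |: S) (fun T => T :\ k)) /=; last first.
  move=> T /andP[/set0Pn[j]]; rewrite inE => /andP[jT jU] TU; apply: setD1K.
  have [<-//|jk] := eqVneq j k; case/negP: TU; apply/set0Pn; exists j.
  by rewrite !inE jT jk.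
apply: eq_big => [S|S /andP[_ /eqP SE]]; last first.
  by rewrite cardsU1 -SE !inE eqxx.
have [kS|kS] := boolP (k \in S).
  rewrite [in LHS](_ : _ == S = false) ?andbF.
    by apply/esym/negbTE/set0Pn; exists k; rewrite inE kS.
  by apply/negP => /eqP SE; move: kS; rewrite -SE !inE eqxx.
rewrite setU1K // eqxx andbT.
have -> : (k |: S) :&: U != set0 by apply/set0Pn; exists k; rewrite !inE eqxx.
rewrite /= negbK; congr (_ == set0); apply/setP => j; rewrite !inE.
by have [->|] := eqVneq j k; rewrite ?(negbTE kS) ?andbF.
Qed.

End FragmentCounting.

(** * Placement and delivery *)

Section XorDelivery.
Local Open Scope nat_scope.
Variables (N K : nat) (d : demand N K).
Implicit Types (f g : 'I_N -> {set 'I_K} -> nat -> bool) (T S U : {set 'I_K}).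

(** [f n S i] is bit [i] of the fragment of file [n] stored by the users of [S]. Decodability is
    proved by comparing two contents [f] and [g] that yield the same observations. *)
Definition xor_msg f U T (i : nat) : bool :=
  \big[addb/false]_(k in T :&: U) f (d k) (T :\ k) i.

Lemma xor_msg_cancel f g U T i k : k \in T -> k \in U ->
  (forall j, j \in T -> j \in U -> j != k ->
     f (d j) (T :\ j) i = g (d j) (T :\ j) i) ->
  xor_msg f U T i = xor_msg g U T i -> f (d k) (T :\ k) i = g (d k) (T :\ k) i.
Proof.
move=> kT kU fg; have kTU : k \in T :&: U by rewrite inE kT.
rewrite /xor_msg (bigD1 k) //= [RHS](bigD1 k) //=.
rewrite [X in _ (+) X](eq_bigr (fun j => g (d j) (T :\ j) i)); last first.
  by move=> j /andP[]; rewrite inE => /andP[jT jU] jk; apply: fg.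
exact: addIb.
Qed.

Variables (f g : 'I_N -> {set 'I_K} -> nat -> bool) (m : nat -> nat).

(** [U] is the group XORed over and [V] selects the sets [T] that are sent: [V = U] for coded
    delivery, a single leader otherwise. Each fragment in the XOR is indexed by [T] minus one user,
    hence [#|T|.-1]. *)
Definition xor_msg_agree U V := forall T i, T :&: V != set0 -> i < m #|T|.-1 ->
  xor_msg f U T i = xor_msg g U T i.

(** If [k] lacks the fragment of [S], take [T = k |: S]: every other summand has an index set
    containing [k], so it is cached. *)
Lemma decode_coded U k S i : xor_msg_agree U U -> k \in U ->
  (forall n S j, k \in S -> f n S j = g n S j) ->
  i < m #|S| -> f (d k) S i = g (d k) S i.
Proof.
move=> fgU kU cached im; have [/cached//|kS] := boolP (k \in S).
rewrite -(setU1K kS); apply: (@xor_msg_cancel _ _ U); rewrite ?setU11 //.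
  by move=> j jS jU jk; apply: cached; rewrite !inE eq_sym jk eqxx.
apply: fgU; last by rewrite cardsU1 kS.
by apply/set0Pn; exists k; rewrite !inE eqxx.
Qed.

(* When all users of [U] want the same file, the messages through a single leader [u]
   suffice: they first reveal the fragments stored at [u], and then all the others. *)
Lemma decode_leader U u k n S i : xor_msg_agree U [set u] -> u \in U -> k \in U ->
  (forall j, j \in U -> d j = n) ->
  (forall n S j, k \in S -> f n S j = g n S j) ->
  i < m #|S| -> f n S i = g n S i.
Proof.
move=> fgU uU kU dU cached.
have stored_at_leader S' j : u \in S' -> j < m #|S'| -> f n S' j = g n S' j.
  move=> uS jm; have [/cached//|kS] := boolP (k \in S').
  rewrite -(setU1K kS) -(dU k kU); apply: (@xor_msg_cancel _ _ U); rewrite ?setU11 //.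
    by move=> j' jS jU jk; apply: cached; rewrite !inE eq_sym jk eqxx.
  apply: fgU; last by rewrite cardsU1 kS.
  by apply/set0Pn; exists u; rewrite !inE eqxx uS orbT.
move=> im; have [uS|uS] := boolP (u \in S); first exact: stored_at_leader.
(* In the message for [u |: S], every other summand belongs to the same file [n], and its index set
   contains [u] and has the size of [S]; it is already known. *)
rewrite -(setU1K uS) -(dU u uU); apply: (@xor_msg_cancel _ _ U); rewrite ?setU11 //.
  move=> j jS jU ju; rewrite dU //; apply: stored_at_leader.
    by rewrite !inE eq_sym ju eqxx.
  by have := cardsD1 j (u |: S); rewrite jS cardsU1 uS => /addnI <-.
apply: fgU; last by rewrite cardsU1 uS.
by apply/set0Pn; exists u; rewrite !inE eqxx.
Qed.

End XorDelivery.

(** * The concrete scheme on files of [F] bits *)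

Lemma card_sigma_ord (I : finType) (m : I -> nat) :
  #|{: {i : I & 'I_(m i)}}| = (\sum_i m i)%N.
Proof.
rewrite card_tagged sumnE big_map big_enum /=.
by apply: eq_bigr => i _; rewrite card_ord.
Qed.

Section FragmentScheme.
Local Open Scope nat_scope.
Variables (N K L F : nat) (blk : 'I_N -> 'I_L) (A B : nat) (c : 'I_L -> nat).
Implicit Types (S T U V : {set 'I_K}) (d : demand N K).
Hypothesis cA : forall l, c l <= A.
Hypothesis AKB : A ^ K * B <= F.

(** [c l / A] is the cached fraction of the files of block [l], and [B] the number of bits per unit
    of weight; the fragments of a file fill [A ^ K * B] of its [F] bits. *)
Definition fragsize l s := fragment_weight K (c l) (A - c l) s * B.

Definition fragpos l := {S : {set 'I_K} & 'I_(fragsize l #|S|)}.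

Definition fragpos_in l (S : {set 'I_K}) (j : 'I_(fragsize l #|S|)) : fragpos l :=
  Tagged (fun S : {set 'I_K} => 'I_(fragsize l #|S|)) j.

Lemma card_fragpos l : #|{: fragpos l}| = A ^ K * B.
Proof.
rewrite card_sigma_ord /fragsize -big_distrl /= sum_fragment_weight.
by rewrite subnKC.
Qed.

Lemma card_fragpos_le l : #|{: fragpos l}| <= F.
Proof. by rewrite card_fragpos. Qed.

(** Fragments are laid out by [enum_rank] over the initial bits of the file. Padding with [false]
    lets bits of fragments of all sizes be indexed by plain naturals. *)
Definition fragbit (W : files N F) n (S : {set 'I_K}) (i : nat) : bool :=
  if insub i is Some j then
    tnth (W n) (widen_ord (card_fragpos_le (blk n))
                  (enum_rank (@fragpos_in (blk n) S j)))
  else false.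

Lemma fragbit_out W n S i : fragsize (blk n) #|S| <= i -> fragbit W n S i = false.
Proof. by move=> im; rewrite /fragbit insubF // ltnNge im. Qed.

Lemma eq_file (W W' : files N F) n :
  (forall S i, fragbit W n S i = fragbit W' n S i) ->
  (forall x : 'I_F, A ^ K * B <= x -> tnth (W n) x = tnth (W' n) x) ->
  W n = W' n.
Proof.
move=> fragE remE; apply: eq_from_tnth => x.
have [xlt|/remE//] := ltnP x (A ^ K * B).
have xr : x < #|{: fragpos (blk n)}| by rewrite card_fragpos.
have := fragE (tag (enum_val (Ordinal xr))) (tagged (enum_val (Ordinal xr))).
rewrite /fragbit valK.
have -> : fragpos_in (tagged (enum_val (Ordinal xr))) = enum_val (Ordinal xr)
  by case: (enum_val _).
by rewrite enum_valK; have -> : widen_ord (card_fragpos_le (blk n)) (Ordinal xr) = x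
  by exact: val_inj.
Qed.

(** [A ^ K * B] times q + ... + q^#|V|, where q = (A - c l) / A. *)
Definition xor_size l (V : {set 'I_K}) :=
  \sum_(i < #|V|) (A - c l) ^ i.+1 * A ^ (K - i.+1) * B.

Definition xor_index l (V : {set 'I_K}) :=
  {T : {set 'I_K} & 'I_(if T :&: V != set0 then fragsize l #|T|.-1 else 0)}.

Lemma card_xor_index l V : #|{: xor_index l V}| = xor_size l V.
Proof.
rewrite card_sigma_ord -big_mkcond /= /fragsize -!big_distrl /=.
by rewrite sum_fragment_weight_meet subnKC // big_distrl.
Qed.

Lemma xor_index_agree (d : demand N K) f g l U V :
  (forall x : xor_index l V, xor_msg d f U (tag x) (tagged x) =
                             xor_msg d g U (tag x) (tagged x)) ->
  xor_msg_agree d f g (fragsize l) U V.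
Proof.
move=> H T i TV im.
have im' : i < (if T :&: V != set0 then fragsize l #|T|.-1 else 0) by rewrite TV.
exact: (H (Tagged (fun T => 'I_(if T :&: V != set0 then _ else _)) (Ordinal im'))).
Qed.

Definition users_of_block (d : demand N K) l := [set k | blk (d k) == l].
Definition users_of_file (d : demand N K) n := [set k | d k == n].
Definition leader (U : {set 'I_K}) : {set 'I_K} :=
  if [pick k in U] is Some k then [set k] else set0.

Lemma card_leader U : #|leader U| <= 1.
Proof. by rewrite /leader; case: pickP => *; rewrite ?cards1 ?cards0. Qed.

(** The cost of leader delivery, charged for every file of the block whether requested or not. *)
Definition uncoded_size l := block_size blk l * ((A - c l) * A ^ K.-1 * B).

Definition use_coded d l := xor_size l (users_of_block d l) <= uncoded_size l.

(* A group is a whole block (coded delivery) or a single file (delivery through a leader). *)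
Definition group_block (G : 'I_L + 'I_N) :=
  match G with inl l => l | inr n => blk n end.
Definition group_users d (G : 'I_L + 'I_N) :=
  match G with inl l => users_of_block d l | inr n => users_of_file d n end.
Definition group_leaders d (G : 'I_L + 'I_N) :=
  match G with
  | inl l => if use_coded d l then users_of_block d l else set0
  | inr n => if use_coded d (blk n) then set0 else leader (users_of_file d n)
  end.

(** In each block only the cheaper option sends anything, and a leader set of at most one user
    leaves at most the first term of [xor_size]. *)
Lemma sum_group_size d :
  \sum_G xor_size (group_block G) (group_leaders d G) <=
  \sum_(l < L) minn (xor_size l (users_of_block d l)) (uncoded_size l).
Proof.
have xor_size0 l : xor_size l set0 = 0 by rewrite /xor_size cards0 big_ord0.
rewrite big_sumType /= [X in _ + X](partition_big blk predT) //= -big_split /=.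
apply: leq_sum => l _.
have [coded|uncoded] := boolP (use_coded d l).
  rewrite big1 ?addn0; last by move=> n /eqP ->; rewrite coded xor_size0.
  by rewrite leq_min leqnn.
rewrite xor_size0 add0n (minn_idPr _); last by rewrite ltnW // ltnNge.
apply: (@leq_trans (\sum_(n | blk n == l) (A - c l) * A ^ K.-1 * B)).
  apply: leq_sum => n /eqP ->; rewrite (negbTE uncoded) /xor_size.
  have := card_leader (users_of_file d n).
  case: #|_| => [|[|//]] _; first by rewrite big_ord0.
  by rewrite big_ord1 expn1 subn1.
rewrite sum_nat_const /uncoded_size /block_size leq_mul2r; apply/orP; right.
by rewrite cardsE.
Qed.

Definition cache_index (k : 'I_K) :=
  {n : 'I_N & {S : {set 'I_K} & 'I_(if k \in S then fragsize (blk n) #|S| else 0)}}.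

Definition cache_bit k (W : files N F) (x : cache_index k) : bool :=
  fragbit W (tag x) (tag (tagged x)) (tagged (tagged x)).

Lemma card_cache_index k :
  #|{: cache_index k}| = \sum_(n < N) c (blk n) * A ^ K.-1 * B.
Proof.
rewrite card_tagged sumnE big_map big_enum /=; apply: eq_bigr => n _.
rewrite card_sigma_ord -big_mkcond /= /fragsize -big_distrl /=.
by rewrite sum_fragment_weight_mem subnKC.
Qed.

(** The bits left over after cutting are sent in the clear, separately for each user. *)
Definition rest_index := ('I_K * 'I_(F - A ^ K * B))%type.

Lemma rest_pos_proof (r : 'I_(F - A ^ K * B)) : A ^ K * B + r < F.
Proof. by rewrite -ltn_subRL. Qed.

Definition rest_pos r := Ordinal (rest_pos_proof r).

Definition msg_index d :=
  ({G : 'I_L + 'I_N & xor_index (group_block G) (group_leaders d G)} + rest_index)%type.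

Definition msg_bit d (W : files N F) (x : msg_index d) : bool :=
  match x with
  | inl y => xor_msg d (fragbit W) (group_users d (tag y))
               (tag (tagged y)) (tagged (tagged y))
  | inr (k, r) => tnth (W (d k)) (rest_pos r)
  end.

Lemma card_msg_index d :
  #|{: msg_index d}| <=
  \sum_(l < L) minn (xor_size l (users_of_block d l)) (uncoded_size l)
    + K * (F - A ^ K * B).
Proof.
rewrite card_sum card_prod !card_ord leq_add2r.
rewrite card_tagged sumnE big_map big_enum /=.
under eq_bigr do rewrite card_xor_index.
exact: sum_group_size.
Qed.

(** Fragments stored at [k] come from the cache, the others from the group serving [k] under the
    option chosen for its block, and the tail of the file from the clear part. *)
Lemma msg_cache_determine d k (W W' : files N F) :
  @cache_bit k W =1 @cache_bit k W' -> @msg_bit d W =1 @msg_bit d W' ->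
  W (d k) = W' (d k).
Proof.
move=> caE msE.
have cached n S j : k \in S -> fragbit W n S j = fragbit W' n S j.
  move=> kS; have [jm|?] := ltnP j (fragsize (blk n) #|S|); last by rewrite !fragbit_out.
  have jm' : j < (if k \in S then fragsize (blk n) #|S| else 0) by rewrite kS.
  exact: (caE (Tagged (fun n => {S : {set 'I_K} & _})
    (Tagged (fun S => 'I_(if k \in S then _ else _)) (Ordinal jm')))).
have agree G : xor_msg_agree d (fragbit W) (fragbit W') (fragsize (group_block G))
    (group_users d G) (group_leaders d G).
  by apply: xor_index_agree => x; apply: (msE (inl (Tagged
    (fun G => xor_index (group_block G) (group_leaders d G)) x))).
apply: eq_file => [S i|x xge]; last first.
  have xr : x - A ^ K * B < F - A ^ K * B by rewrite ltn_sub2r // (leq_ltn_trans xge).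
  have := msE (inr (k, Ordinal xr)); rewrite /msg_bit.
  by have -> : rest_pos (Ordinal xr) = x by apply: val_inj; rewrite /= subnKC.
have [im|?] := ltnP i (fragsize (blk (d k)) #|S|); last by rewrite !fragbit_out.
have [coded|uncoded] := boolP (use_coded d (blk (d k))).
  have := agree (inl (blk (d k))); rewrite /= coded => agr.
  by apply: (decode_coded agr) => //; rewrite inE.
have := agree (inr (d k)); rewrite /= (negbTE uncoded) /leader.
have kU : k \in users_of_file d (d k) by rewrite inE.
(* A leader exists because [k] itself requests this file. *)
case: pickP => [u uU agr|/(_ k)]; last by rewrite kU.
by apply: (decode_leader agr uU kU) => // j; rewrite inE => /eqP.
Qed.

Lemma fragment_scheme : exists S : scheme N K F,
  [/\ forall k, cache_len S k = \sum_(n < N) c (blk n) * A ^ K.-1 * B,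
      forall d, msg_len S d <=
        \sum_(l < L) minn (xor_size l (users_of_block d l)) (uncoded_size l)
          + K * (F - A ^ K * B)
    & forall d k W, decode S d k (encode S d W) (cache S k W) = W (d k)].
Proof.
have [S [caS msS deS]] := zero_error_scheme msg_cache_determine.
exists S; split=> // [k|d]; first by rewrite caS card_cache_index.
by rewrite msS card_msg_index.
Qed.

End FragmentScheme.

(** * The rate function and the optimal memory split *)

Section RateFunction.
Variable R : realType.

(* [Rfun] as a function of the fraction [q] of each file that a user does not cache. *)
Definition miss_rate (N K : nat) (q : R) : R :=
  Num.min (\sum_(i < K) q ^+ i.+1) (q * N%:R).

Definition miss_fraction (M : R) (N : nat) : R := Num.max 0 (1 - M / N%:R).

Lemma miss_fraction_ge0 M N : 0 <= miss_fraction M N.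
Proof. by rewrite le_max lexx. Qed.

Lemma miss_fraction_le1 M N : 0 <= M -> miss_fraction M N <= 1.
Proof. by move=> M0; rewrite ge_max ler01 gerBl divr_ge0. Qed.

(** With q = 1 - M / N, N / M is 1 / (1 - q), and a geometric sum removes the division by [M]. The
    special cases [M = 0] and [M > N] are q = 1 and q = 0. *)
Lemma Rfun_miss_rate M N K : (0 < N)%N -> 0 <= M ->
  Rfun M N K = miss_rate N K (miss_fraction M N).
Proof.
move=> N0 M0; have N0' : 0 < N%:R :> R by rewrite ltr0n.
rewrite /Rfun /miss_rate /miss_fraction; case: eqP => [->|/eqP Mneq0].
  rewrite mul0r subr0 (max_idPr ler01) mul1r.
  under eq_bigr do rewrite expr1n.
  by rewrite sumr_const card_ord minC -natr_min.
have [MN|MN] := leP M N%:R; last first.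
  rewrite (max_idPl _); last by rewrite subr_le0 ler_pdivlMr // mul1r ltW.
  rewrite mul0r big1 ?minxx // => i _; exact: expr0n.
have q0 : 0 <= 1 - M / N%:R by rewrite subr_ge0 ler_pdivrMr ?mul1r.
rewrite (max_idPr q0) minr_pMr //; congr Num.min.
set q := 1 - M / N%:R; have -> : N%:R / M = (1 - q)^-1.
  by rewrite /q subKr invf_div.
have q1 : 1 - q != 0.
  by rewrite /q subKr mulf_neq0 // ?invr_eq0 gt_eqF.
under [in RHS]eq_bigr do rewrite exprS.
rewrite -mulr_sumr -[X in X - q ^+ K](expr1n _ K) subrXX; congr (_ * _).
rewrite mulKf //; apply: eq_bigr => i _; by rewrite expr1n mul1r.
Qed.

Lemma continuous_miss_rate (N K : nat) : continuous (miss_rate N K).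
Proof.
move=> q; apply: (@continuous_min _ _ (fun q : R => \sum_(i < K) q ^+ i.+1)
  (fun q : R => q * N%:R)); last first.
  by apply: continuousM; [exact: cvg_id | exact: cst_continuous].
apply: continuous_big => [|i _]; first exact: add_continuous.
exact: exprn_continuous.
Qed.

Lemma continuous_miss_fraction (N : nat) : continuous (miss_fraction ^~ N).
Proof.
move=> M; apply: (@continuous_max _ _ (fun=> 0) (fun M : R => 1 - M / N%:R)); first exact: cst_continuous.
apply: continuousB; first exact: cst_continuous.
by apply: continuousM; [exact: cvg_id | exact: cst_continuous].
Qed.

(** A one-sided Lipschitz bound that absorbs rounding: on [0, 1] the power i grows by at most i h,
    and each of the [K] exponents is at most [K]. *)
Lemma miss_rate_perturb (N K : nat) (q q' h : R) : 0 <= q <= 1 -> 0 <= q' <= 1 ->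
  0 <= h -> q' <= q + h ->
  miss_rate N K q' <= miss_rate N K q + (K * K + N)%:R * h.
Proof.
move=> /andP[q0 q1] /andP[q'0 q'1] h0 q'q.
have pow i : q' ^+ i <= q ^+ i + i%:R * h.
  elim: i => [|i IHi]; first by rewrite !expr0 mul0r addr0.
  rewrite !exprS -natr1.
  have qi0 : 0 <= q ^+ i by rewrite exprn_ge0.
  have qi1 : q ^+ i <= 1 by rewrite exprn_ile1.
  have ih0 : 0 <= i%:R * h by rewrite mulr_ge0.
  apply: (le_trans (ler_wpM2l q'0 IHi)); rewrite mulrDr.
  apply: (le_trans (lerD (ler_wpM2r qi0 q'q) (ler_piMl ih0 q'1))).
  have : h * q ^+ i <= h by rewrite ler_piMr.
  lra.
have sums : \sum_(i < K) q' ^+ i.+1 <= \sum_(i < K) q ^+ i.+1 + (K * K)%:R * h.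
  have -> : (K * K)%:R * h = \sum_(i < K) K%:R * h.
    by rewrite sumr_const card_ord -[RHS]mulr_natl mulrA -natrM.
  rewrite -big_split /=; apply: ler_sum => i _.
  by apply: (le_trans (pow _)); rewrite lerD2l ler_wpM2r // ler_nat.
have KKh : 0 <= (K * K)%:R * h by rewrite mulr_ge0.
have Nh : 0 <= N%:R * h by rewrite mulr_ge0.
have lin : q' * N%:R <= q * N%:R + N%:R * h.
  by rewrite [N%:R * h]mulrC -mulrDl ler_wpM2r.
rewrite /miss_rate natrD mulrDl -lerBlDr le_min !lerBlDr; apply/andP; split.
  by apply: (le_trans (y := \sum_(i < K) q' ^+ i.+1)); [rewrite ge_min lexx|lra].
by apply: (le_trans (y := q' * N%:R)); [rewrite ge_min lexx orbT|lra].
Qed.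

End RateFunction.

(** * Existence of an optimal memory split *)

Section OptimalSplit.
Variables (R : realType) (N K L : nat) (p : 'I_N -> R) (blk : 'I_N -> 'I_L).

Lemma block_size_gt0 : (forall l, exists n, blk n = l) ->
  forall l, (0 < block_size blk l)%N.
Proof. by move=> blks l; have [n <-] := blks l; apply/card_gt0P; exists n; rewrite inE. Qed.

Lemma split_rate_miss_rate (Ms : 'I_L -> R) :
  (forall l, exists n, blk n = l) -> (forall l, 0 <= Ms l) ->
  split_rate K p blk Ms =
  \sum_(l < L) \sum_(d : demand N K) dprob p d *
    miss_rate (block_size blk l) (block_users blk l d)
      (miss_fraction (Ms l) (block_size blk l)).
Proof.
move=> blks Ms0; apply: eq_bigr => l _; apply: eq_bigr => d _.
by rewrite Rfun_miss_rate // block_size_gt0.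
Qed.

(** Extreme value theorem: the feasible splits form a nonempty closed subset of the compact box
    [0, M]^L. *)
Lemma exists_optimal_split (M : R) : 0 <= M -> (0 < L)%N ->
  (forall l, exists n, blk n = l) ->
  exists2 Ms0 : 'I_L -> R, feasible_split M Ms0 &
    forall Ms, feasible_split M Ms ->
      split_rate K p blk Ms0 <= split_rate K p blk Ms.
Proof.
move=> M0 L0 blks.
(* [split_rate] in its division-free form, visibly continuous on all row vectors. *)
pose G (v : 'rV[R]_L) := \sum_(l < L) \sum_(d : demand N K) dprob p d *
    miss_rate (block_size blk l) (block_users blk l d)
      (miss_fraction (v ord0 l) (block_size blk l)).
have contG : continuous G.
  apply: continuous_big => [|l _]; first exact: add_continuous.
  apply: continuous_big => [|d _]; first exact: add_continuous.
  move=> v; apply: (@continuousM R _ (fun=> dprob p d) (fun v : 'rV[R]_L =>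
    miss_rate (block_size blk l) (block_users blk l d)
      (miss_fraction (v ord0 l) (block_size blk l)))); first exact: cst_continuous.
  have coord : continuous (fun v : 'rV[R]_L => v ord0 l) by exact: coord_continuous.
  have frac := continuous_comp (coord v) (@continuous_miss_fraction R (block_size blk l) _).
  exact: (continuous_comp frac (@continuous_miss_rate R _ _ _)).
pose D : set 'rV[R]_L := [set v | feasible_split M (v ord0)]%classic.
have D0 : (D !=set0)%classic.
  exists (const_mx (M / L%:R)); split=> [l|]; first by rewrite mxE divr_ge0.
  under eq_bigr do rewrite mxE.
  by rewrite sumr_const card_ord -[LHS]mulr_natr divfK // pnatr_eq0 -lt0n.
have compD : compact D.
  have box := rV_compact (fun l : 'I_L => @segment_compact R 0 M).
  apply: (subclosed_compact _ box) => [|v [v0 vM] l /=]; last first.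
    rewrite in_itv /= v0 /= -vM (bigD1 l) //= lerDl.
    by apply: sumr_ge0 => j _.
  have -> : D = ((\bigcap_(l in [set: 'I_L]) ((fun v : 'rV[R]_L => v ord0 l) @^-1`
      [set x : R | 0 <= x])) `&`
    ((fun v : 'rV[R]_L => \sum_(l < L) v ord0 l) @^-1` [set x | x = M]))%classic.
    apply/seteqP; split=> v /= [v0 vM]; split=> // l; first by move=> _; apply: v0.
    exact: v0.
  apply: closedI.
    apply: closed_bigI => l _; apply: preimage_closed; last exact: closed_ge.
    by move=> v _; apply: coord_continuous.
  apply: preimage_closed; last exact: closed_eq.
  move=> v _; apply: continuous_big => [|l _]; first exact: add_continuous.
  exact: coord_continuous.
have [v] := EVT_min_rV D0 compD (continuous_subspaceT contG).
move=> /set_mem[v0 vM] Gmin.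
exists (fun l => v ord0 l) => [|Ms [Ms0 MsM]]; first by split.
rewrite !split_rate_miss_rate //.
have MsD : feasible_split M ((\row_l Ms l) ord0).
  by split=> [l|]; [rewrite mxE | under eq_bigr do rewrite mxE].
have /le_trans -> // := Gmin (\row_l Ms l) (mem_set MsD).
rewrite le_eqVlt; apply/orP; left; apply/eqP; apply: eq_bigr => l _.
by apply: eq_bigr => d _; rewrite mxE.
Qed.

End OptimalSplit.

(** * Achievability *)

Section Achievability.
Variable R : realType.

Lemma dprob_ge0 (N K : nat) (p : 'I_N -> R) (d : demand N K) :
  (forall n, 0 <= p n) -> 0 <= dprob p d.
Proof. by move=> p0; apply: prodr_ge0. Qed.

Lemma sum_dprob (N K : nat) (p : 'I_N -> R) :
  \sum_(n < N) p n = 1 -> \sum_(d : demand N K) dprob p d = 1.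
Proof.
move=> p1; rewrite -(bigA_distr_bigA (fun=> p)) /=.
by rewrite big1.
Qed.

(** An infimum lies below its members once the set is bounded below; 0 is a bound because every
    scheme has a nonnegative expected rate. *)
Lemma Rstar_le (N K : nat) (M : R) (p : 'I_N -> R) (r : R) :
  (forall n, 0 <= p n) -> achievable K M p r -> Rstar K M p <= r.
Proof.
move=> p0 ach; apply: ge_inf => //; exists 0 => r' /(_ 1 ltr01)[F0 /(_ _ (leqnn _))].
move=> [S [_ _]]; apply: le_trans; apply: sumr_ge0 => d _.
by rewrite mulr_ge0 ?dprob_ge0 ?divr_ge0.
Qed.

Lemma err_prob0 (N K F : nat) (S : scheme N K F) (d : demand N K) :
  (forall k W, decode S d k (encode S d W) (cache S k W) = W (d k)) ->
  err_prob R S d = 0.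
Proof.
move=> correct; rewrite /err_prob (_ : [set _ | _]%SET = set0) ?cards0 ?mul0r //.
apply/setP => W; rewrite !inE; apply/negbTE/existsPn => k.
by rewrite negbK correct.
Qed.

(** The memory [Ms l] is shared equally among the files of block [l]; this serves to check the cache
    budget. *)
Lemma sum_block_share (N L : nat) (blk : 'I_N -> 'I_L) (Ms : 'I_L -> R) :
  (forall l, exists n, blk n = l) ->
  \sum_(n < N) Ms (blk n) / (block_size blk (blk n))%:R = \sum_(l < L) Ms l.
Proof.
move=> blks; rewrite (partition_big blk predT) //=; apply: eq_bigr => l _.
rewrite (eq_bigr (fun=> Ms l / (block_size blk l)%:R)); last by move=> n /eqP ->.
rewrite sumr_const -[LHS]mulr_natr.
have -> : #|[pred n | blk n == l]| = block_size blk l by rewrite /block_size cardsE.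
by rewrite divfK // pnatr_eq0 -lt0n block_size_gt0.
Qed.

(* [quantized_cache A x / A] approximates the cached fraction [min x 1] from below. *)
Definition quantized_cache (A : nat) (x : R) : nat := minn A (Num.trunc (A%:R * x)).

Lemma quantized_cache_le (A : nat) (x : R) :
  0 <= x -> (quantized_cache A x)%:R <= A%:R * x.
Proof.
move=> x0; apply: (le_trans (y := (Num.trunc (A%:R * x))%:R)).
  by rewrite ler_nat geq_minr.
by rewrite truncn_le mulr_ge0.
Qed.

Lemma quantized_miss (A : nat) (x : R) : (0 < A)%N ->
  (A - quantized_cache A x)%:R / A%:R <= Num.max 0 (1 - x) + A%:R^-1.
Proof.
move=> A0; have A0' : 0 < A%:R :> R by rewrite ltr0n.
have iA : 0 < A%:R^-1 :> R by rewrite invr_gt0.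
rewrite natrB ?geq_minl // mulrBl divff ?gt_eqF // /quantized_cache.
have [_|_] := leqP A (Num.trunc (A%:R * x)).
  rewrite divff ?gt_eqF // subrr.
  by apply: addr_ge0; [rewrite le_max lexx|exact: ltW].
have tr : A%:R * x < (Num.trunc (A%:R * x))%:R + 1 by rewrite natr1 truncnS_gt.
apply: (le_trans (y := 1 - x + A%:R^-1)); last by rewrite lerD2r le_max lexx orbT.
rewrite -addrA lerD2l -subr_ge0.
have -> : - x + A%:R^-1 - - ((Num.trunc (A%:R * x))%:R / A%:R) =
   ((Num.trunc (A%:R * x))%:R + 1 - A%:R * x) / A%:R.
  by field; rewrite gt_eqF.
by rewrite divr_ge0 ?ltW // subr_gt0.
Qed.

Lemma block_message_size (N K L : nat) (blk : 'I_N -> 'I_L) (A B : nat)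
    (c : 'I_L -> nat) (d : demand N K) l : (0 < A)%N ->
  (minn (xor_size A B c l (users_of_block blk d l)) (uncoded_size K blk A B c l))%:R
  <= (A ^ K * B)%:R * miss_rate (block_size blk l) (block_users blk l d)
       ((A - c l)%:R / A%:R) :> R.
Proof.
move=> A0; have A0' : A%:R != 0 :> R by rewrite pnatr_eq0 -lt0n.
rewrite /miss_rate minr_pMr ?ler0n // le_min; apply/andP; split.
  apply: (le_trans (y := (xor_size A B c l (users_of_block blk d l))%:R)).
    by rewrite ler_nat geq_minl.
  rewrite le_eqVlt; apply/orP; left; apply/eqP.
  rewrite /xor_size natr_sum mulr_sumr; apply: eq_bigr => i _.
  have iK : (i < K)%N.
    by apply: leq_trans (ltn_ord i) _; rewrite -[leqRHS]card_ord max_card.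
  rewrite !natrM !natrX expr_div_n -[in X in _ = X * _ * _](subnK iK) exprD.
  by field; rewrite expf_neq0.
(* For [K = 0] the identity [A ^ K = A * A ^ K.-1] fails, but the coded message is then empty and
   the minimum is 0. *)
have [K0|K0] := posnP K.
  apply: (le_trans (y := 0)); last by rewrite !mulr_ge0 // invr_ge0.
  rewrite lern0 -leqn0; apply: leq_trans (geq_minl _ _) _.
  have : (#|users_of_block blk d l| <= K)%N by rewrite -[leqRHS]card_ord max_card.
  by rewrite [X in (_ <= X)%N]K0 leqn0 /xor_size => /eqP ->; rewrite big_ord0.
apply: (le_trans (y := (uncoded_size K blk A B c l)%:R)).
  by rewrite ler_nat geq_minr.
rewrite le_eqVlt; apply/orP; left; apply/eqP.
rewrite /uncoded_size -[in X in _ = (A ^ X * _)%:R * _](prednK K0) expnS !natrM.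
by field.
Qed.

(** Half of [delta] pays for rounding cached fractions to multiples of 1/A, the other half for the
    uncut tails, at most [A ^ K] bits per user and negligible for large [F]. *)
Lemma achievable_split (N K L : nat) (M : R) (p : 'I_N -> R) (blk : 'I_N -> 'I_L)
    (Ms : 'I_L -> R) (delta : R) :
  (forall n, 0 <= p n) -> \sum_(n < N) p n = 1 -> (forall l, exists n, blk n = l) ->
  feasible_split M Ms -> 0 < delta ->
  achievable K M p (split_rate K p blk Ms + delta).
Proof.
move=> p0 p1 blks [Ms0 MsM] delta0 eps eps0.
(* The Lipschitz constants of [miss_rate] summed over the blocks, with [K] bounding the users of
   each block. *)
pose h : R := \sum_(l < L) (K * K + block_size blk l)%:R.
have archi (x : R) : exists2 n, (0 < n)%N & x / n%:R <= delta / 2.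
  have xd0 : 0 <= `|x| / (delta / 2) by rewrite divr_ge0 // ltW // divr_gt0.
  exists (Num.trunc (`|x| / (delta / 2))).+1 => //.
  rewrite ler_pdivrMr ?ltr0n // mulrC -ler_pdivrMr ?divr_gt0 //.
  apply: le_trans (ltW (truncnS_gt _)).
  by rewrite ler_pM2r ?invr_gt0 ?divr_gt0 // ler_norm.
have [A A0 hA] := archi h.
have [F0 F00 hF] := archi (K * A ^ K)%:R.
exists F0 => F F0F; have Fgt0 : (0 < F)%N by exact: leq_trans F0F.
have FR0 : 0 < F%:R :> R by rewrite ltr0n.
have AR0 : 0 < A%:R :> R by rewrite ltr0n.
pose B := (F %/ A ^ K)%N.
have AKB : (A ^ K * B <= F)%N by rewrite mulnC leq_divM.
have rest : (F - A ^ K * B <= A ^ K)%N.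
  by rewrite leq_subLR mulnC {1}(divn_eq F (A ^ K)) leq_add2l ltnW // ltn_pmod // expn_gt0 A0.
pose share l := Ms l / (block_size blk l)%:R.
have share0 l : 0 <= share l by rewrite divr_ge0.
pose c l := quantized_cache A (share l).
have cA l : (c l <= A)%N by exact: geq_minl.
have [S [cacheS msgS decS]] := fragment_scheme blk cA AKB.
exists S; split=> [k|d|].
- have K0 : (0 < K)%N by apply: leq_ltn_trans (ltn_ord k).
  rewrite cacheS natr_sum -MsM -(sum_block_share Ms blks).
  apply: (le_trans (y := (\sum_(n < N) share (blk n)) * (A ^ K * B)%:R)); last first.
    by rewrite ler_wpM2l ?ler_nat // sumr_ge0.
  rewrite mulr_suml; apply: ler_sum => n _.
  rewrite -[in X in (A ^ X * _)%:R](prednK K0) expnS -!mulnA natrM [in leRHS]natrM mulrA.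
  by rewrite ler_wpM2r // mulrC quantized_cache_le.
- by rewrite err_prob0 ?ltW.
pose q l := (A - c l)%:R / A%:R : R.
have msg_le d : (msg_len S d)%:R / F%:R <=
    \sum_(l < L) miss_rate (block_size blk l) (block_users blk l d)
       (miss_fraction (Ms l) (block_size blk l)) + delta.
  rewrite ler_pdivrMr //.
  apply: (le_trans (y := \sum_(l < L) F%:R *
     miss_rate (block_size blk l) (block_users blk l d) (q l) + (K * A ^ K)%:R)).
    have := msgS d; rewrite -(ler_nat R) natrD natr_sum => /le_trans; apply.
    apply: lerD; last by rewrite ler_nat leq_mul2l rest orbT.
    apply: ler_sum => l _; apply: (le_trans (block_message_size _ _ _ _ _ _)) => //.
    rewrite ler_wpM2r ?ler_nat // /miss_rate le_min sumr_ge0 /=.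
      by rewrite mulr_ge0 // divr_ge0.
    by move=> i _; rewrite exprn_ge0 // divr_ge0.
  rewrite -mulr_sumr [leRHS]mulrC.
  have restF : (K * A ^ K)%:R <= F%:R * (delta / 2).
    move: hF; rewrite ler_pdivrMr ?ltr0n // => /le_trans; apply.
    by rewrite mulrC ler_wpM2r ?ler_nat // ltW // divr_gt0.
  apply: le_trans (lerD (lexx _) restF) _; rewrite -mulrDr ler_wpM2l //.
  rewrite [X in _ <= _ + X](splitr delta) addrA lerD2r.
  apply: (le_trans (y := \sum_(l < L) (miss_rate (block_size blk l) (block_users blk l d)
       (miss_fraction (Ms l) (block_size blk l)) + (K * K + block_size blk l)%:R / A%:R))).
    apply: ler_sum => l _.
    have usersK : (block_users blk l d <= K)%N by rewrite -[leqRHS]card_ord max_card.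
    apply: (le_trans (y := miss_rate (block_size blk l) (block_users blk l d)
       (miss_fraction (Ms l) (block_size blk l)) +
       (block_users blk l d * block_users blk l d + block_size blk l)%:R / A%:R)).
      apply: miss_rate_perturb; rewrite ?invr_ge0 ?miss_fraction_ge0 ?miss_fraction_le1 //.
        by rewrite divr_ge0 //= ler_pdivrMr // mul1r ler_nat leq_subr.
      exact: quantized_miss.
    by rewrite lerD2l ler_wpM2r ?invr_ge0 // ler_nat leq_add2r leq_mul.
  by rewrite big_split /= lerD2l -mulr_suml.
(* Average the bound for each demand; the probabilities sum to 1, so [delta] is added once. *)
rewrite /exp_rate split_rate_miss_rate // exchange_big /=.
rewrite -[X in _ <= _ + X]mul1r -[X in _ <= _ + X * _](sum_dprob K p1) mulr_suml -big_split /=.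
apply: ler_sum => d _; rewrite -mulr_sumr -mulrDr.
by apply: ler_wpM2l; [exact: dprob_ge0 | exact: msg_le].
Qed.

End Achievability.

Theorem theorem1 (R : realType) (N K L : nat) (M : R) (p : 'I_N -> R)
    (blk : 'I_N -> 'I_L) :
  (0 < N)%N -> 0 <= M ->
  (forall n, 0 <= p n) -> \sum_(n < N) p n = 1 ->
  (forall l : 'I_L, exists n, blk n = l) ->
  exists Ms0 : 'I_L -> R,
    [/\ feasible_split M Ms0,
        (forall Ms, feasible_split M Ms ->
           split_rate K p blk Ms0 <= split_rate K p blk Ms),
        Rstar K M p <= split_rate K p blk Ms0
      & split_rate K p blk Ms0 <= split_rate K p blk (fun _ => M / L%:R)].
Proof.
move=> N0 M0 p0 p1 blks.
have L0 : (0 < L)%N by apply: leq_ltn_trans (ltn_ord (blk (Ordinal N0))).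
have [Ms0 fMs0 optMs0] := exists_optimal_split K p M0 L0 blks.
exists Ms0; split=> //.
  (* The split rate is shown achievable up to any positive [delta], which suffices for an
     infimum. *)
  by apply/ler_addgt0Pr => delta delta0; apply: Rstar_le => //; exact: achievable_split.
apply: optMs0; split=> [l|]; first by rewrite divr_ge0.
by rewrite sumr_const card_ord -[LHS]mulr_natr divfK // pnatr_eq0 -lt0n.
Qed.
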